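(* Let a group $K$ act on a group $H$ by automorphisms such that the induced action on $H^{\mathrm{ab}}\otimes\mathbb Q$ (or, equivalently, on $H^{\mathrm{abf}}$) is trivial. Then $H\rtimes K$ is RTFN if and only if $H$ and $K$ are.
   Context: $H^{\mathrm{ab}}$ is the abelianization of $H$ and $H^{\mathrm{abf}}$ its quotient by its torsion subgroup. A group $G$ is residually torsion-free nilpotent (RTFN) if for every $g\in G\setminus\{1\}$ there is a surjective morphism from $G$ onto a torsion-free nilpotent group whose value at $g$ is non-trivial. *)

(* Defs.v *)
From HB Require Import structures.
From mathcomp Require Import all_boot all_order all_algebra generic_quotient.
From mathcomp Require Import boolp classical_sets.
From mathcomp Require Import freeg.

Set Implicit Arguments.
Unset Strict Implicit.
Unset Printing Implicit Defensive.

Import GRing.Theory.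

Local Open Scope group_scope.
Local Open Scope classical_set_scope.
Local Open Scope quotient_scope.

(* Groups are possibly infinite: [groupType], not [finGroupType]. *)

Inductive generated (G : groupType) (A : set G) : set G :=
| generated_in x : A x -> generated A x
| generated1 : generated A 1
| generatedM x y : generated A x -> generated A y -> generated A (x * y)
| generatedV x : generated A x -> generated A x^-1.

Definition commutator (G : groupType) (A B : set G) : set G :=
  generated [set z | exists x y, [/\ A x, B y & z = [~ x, y]]].

(* [lower_central n] is the (n+1)-st term of the lower central series. *)
Fixpoint lower_central (G : groupType) (n : nat) : set G :=
  if n is m.+1 then commutator (@lower_central G m) setT else setT.

Arguments lower_central G n : clear implicits.

Definition nilpotent_group (G : groupType) : Prop :=
  exists n, lower_central G n `<=` [set 1].

Definition torsion_free_group (G : groupType) : Prop :=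
  forall (x : G) (n : nat), (0 < n)%N -> x ^+ n = 1 -> x = 1.

Definition RTFN (G : groupType) : Prop :=
  forall g : G, g <> 1 ->
  exists (N : groupType) (f : UMagmaMorphism.type G N),
    [/\ torsion_free_group N, nilpotent_group N,
        (forall y : N, exists x : G, f x = y) & f g <> 1].

(* Left actions by automorphisms; each [aut_act a k] is bijective, with
   inverse [aut_act a k^-1]. *)
Record aut_action (K H : groupType) := AutAction {
  aut_act :> K -> UMagmaMorphism.type H H;
  aut_act1 : forall x, aut_act 1 x = x;
  aut_actM : forall k l x, aut_act (k * l) x = aut_act k (aut_act l x)
}.

(* The alias hides the direct product structure carried by [H * K]. *)
Definition semidirect (K H : groupType) (a : aut_action K H) : Type :=
  (H * K)%type.

Section Semidirect.
Variables (K H : groupType) (a : aut_action K H).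
Local Notation S := (semidirect a).

Definition sd_one : S := (1, 1).
Definition sd_mul (x y : S) : S := (x.1 * a x.2 y.1, x.2 * y.2).
Definition sd_inv (x : S) : S := (a x.2^-1 x.1^-1, x.2^-1).

Lemma sd_mulA : associative sd_mul.
Proof.
by move=> x y z; congr (_, _); rewrite /= ?mulgA // aut_actM gmulfM mulgA.
Qed.

Lemma sd_mul1 : left_id sd_one sd_mul.
Proof. by case=> h k; congr (_, _); rewrite /= mul1g ?aut_act1. Qed.

Lemma sd_mulr1 : right_id sd_one sd_mul.
Proof. by case=> h k; congr (_, _); rewrite /= ?gmulf1 mulg1. Qed.

Lemma sd_mulV : left_inverse sd_one sd_inv sd_mul.
Proof.
by case=> h k; congr (_, _); rewrite /= ?mulVg // -gmulfM mulVg gmulf1.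
Qed.

Lemma sd_mulrV : right_inverse sd_one sd_inv sd_mul.
Proof.
case=> h k; congr (_, _); rewrite /= ?mulgV //.
by rewrite -aut_actM mulgV aut_act1 mulgV.
Qed.

HB.instance Definition _ := Choice.copy S (H * K)%type.
HB.instance Definition _ :=
  isGroup.Build S sd_mulA sd_mul1 sd_mulr1 sd_mulV sd_mulrV.

End Semidirect.

(* Abelianization, written additively. *)

Section Abelianization.
Variable G : groupType.

Definition derived : set G := commutator setT setT.

Definition ab_eq (x y : G) : bool := `[< derived (x * y^-1) >].

Lemma derived_comm (x y : G) : derived [~ x, y].
Proof. by apply: generated_in; exists x, y. Qed.

Lemma derivedJ (x y : G) : derived x -> derived (x ^ y).
Proof.
move=> dx; have -> : x ^ y = x * [~ x, y] by rewrite commgEl mulVKg.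
by apply: generatedM => //; apply: derived_comm.
Qed.

Lemma ab_eq_refl : reflexive ab_eq.
Proof. by move=> x; apply/asboolP; rewrite mulgV; apply: generated1. Qed.

Lemma ab_eq_sym : symmetric ab_eq.
Proof.
by move=> x y; apply/asboolP/asboolP => /generatedV; rewrite invgM invgK.
Qed.

Lemma ab_eq_trans : transitive ab_eq.
Proof.
move=> y x z /asboolP dxy /asboolP dyz; apply/asboolP.
by rewrite -(mulgVK y x) -mulgA; apply: generatedM.
Qed.

Canonical ab_eq_equiv := EquivRel ab_eq ab_eq_refl ab_eq_sym ab_eq_trans.

Definition ab : Type := {eq_quot ab_eq}.
HB.instance Definition _ : EqQuotient G ab_eq ab := EqQuotient.on ab.
HB.instance Definition _ := Choice.on ab.

Definition ab_pi (x : G) : ab := \pi_ab x.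

Lemma ab_piP (x y : G) : ab_pi x = ab_pi y <-> derived (x * y^-1).
Proof.
split=> [/eqmodP/asboolP //|dxy].
by apply/eqmodP; apply/asboolP.
Qed.

Lemma ab_piK (u : ab) : ab_pi (repr u) = u.
Proof. exact: reprK. Qed.

Definition ab_zero : ab := ab_pi 1.
Definition ab_opp (u : ab) : ab := ab_pi (repr u)^-1.
Definition ab_add (u v : ab) : ab := ab_pi (repr u * repr v).

Lemma ab_piM (x y : G) : ab_pi (x * y) = ab_add (ab_pi x) (ab_pi y).
Proof.
rewrite /ab_add; apply/ab_piP; set x' := repr _; set y' := repr _.
have dx : derived (x * x'^-1) by apply/ab_piP; rewrite ab_piK.
have dy : derived (y * y'^-1) by apply/ab_piP; rewrite ab_piK.
suff -> : x * y * (x' * y')^-1 = (y * y'^-1) ^ x^-1 * (x * x'^-1).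
  by apply: generatedM => //; apply: derivedJ.
by rewrite /conjg invgK invgM !mulgA mulgVK.
Qed.

Lemma ab_piV (x : G) : ab_pi x^-1 = ab_opp (ab_pi x).
Proof.
rewrite /ab_opp; apply/ab_piP; set x' := repr _.
have /(derivedJ x') : derived (x' * x^-1) by apply/ab_piP; rewrite ab_piK.
by rewrite /conjg invgK !mulgA mulVg mul1g.
Qed.

Lemma ab_addA : associative ab_add.
Proof.
move=> u v w; rewrite -(ab_piK u) -(ab_piK v) -(ab_piK w).
by rewrite -!ab_piM mulgA.
Qed.

Lemma ab_addC : commutative ab_add.
Proof.
move=> u v; rewrite -(ab_piK u) -(ab_piK v) -!ab_piM; apply/ab_piP.
set x := repr u; set y := repr v.
have -> : x * y * (y * x)^-1 = [~ x^-1, y^-1].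
  by rewrite /commg /conjg !invgK invgM !mulgA.
exact: derived_comm.
Qed.

Lemma ab_add0 : left_id ab_zero ab_add.
Proof. by move=> u; rewrite -(ab_piK u) -ab_piM mul1g. Qed.

Lemma ab_addN : left_inverse ab_zero ab_opp ab_add.
Proof. by move=> u; rewrite -(ab_piK u) -ab_piV -ab_piM mulVg. Qed.

HB.instance Definition _ :=
  GRing.isZmodule.Build ab ab_addA ab_addC ab_add0 ab_addN.

Lemma ab_piD (x y : G) : ab_pi (x * y) = (ab_pi x + ab_pi y)%R.
Proof. exact: ab_piM. Qed.

Lemma ab_piB (x y : G) : ab_pi (x / y) = (ab_pi x - ab_pi y)%R.
Proof. by rewrite ab_piM ab_piV. Qed.

End Abelianization.

Section AbelianizationMap.
Variables (G H : groupType) (f : UMagmaMorphism.type G H).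

(* The value does not depend on the representative, by [ab_map_pi]. *)
Definition ab_map (u : ab G) : ab H := ab_pi (f (repr u)).

Lemma derived_map x : derived x -> derived (f x).
Proof.
elim=> {x} [x [y [z [_ _ ->]]]||x y _ dx _ dy|x _ dx].
- by rewrite gmulfR; apply: derived_comm.
- by rewrite gmulf1; apply: generated1.
- by rewrite gmulfM; apply: generatedM.
- by rewrite gmulfV; apply: generatedV.
Qed.

Lemma ab_map_pi x : ab_map (ab_pi x) = ab_pi (f x).
Proof.
apply/ab_piP; rewrite -gmulfV -gmulfM; apply: derived_map.
by apply/ab_piP; rewrite ab_piK.
Qed.

Lemma ab_map_additive : zmod_morphism ab_map.
Proof.
move=> u v; rewrite -[u]ab_piK -[v]ab_piK; move: (repr u) (repr v) => x y.
by rewrite -ab_piB !ab_map_pi gmulfF ab_piB.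
Qed.

HB.instance Definition _ :=
  GRing.isZmodMorphism.Build (ab G) (ab H) ab_map ab_map_additive.

End AbelianizationMap.

Local Open Scope ring_scope.

(* Quotient of an abelian group by its torsion subgroup. *)

Section TorsionFreeQuotient.
Variable V : zmodType.

Definition torsion : {pred V} :=
  fun x => `[< exists2 n : nat, (0 < n)%N & x *+ n = 0 >].

Lemma torsion_zmod_closed : zmod_closed torsion.
Proof.
split=> [|x y /asboolP [m m0 xm] /asboolP [n n0 yn]]; apply/asboolP.
  by exists 1%N.
exists (m * n)%N; first by rewrite muln_gt0 m0.
by rewrite mulrnBl mulrnA xm mul0rn mulnC mulrnA yn mul0rn subrr.
Qed.

HB.instance Definition _ := GRing.isZmodClosed.Build V torsion
  torsion_zmod_closed.

Definition tf_quot : zmodType := Quotient.quot torsion.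

Definition tf_pi (x : V) : tf_quot := \pi_(Quotient.quot torsion) x.

End TorsionFreeQuotient.

Section TorsionFreeQuotientMap.
Variables (V W : zmodType) (f : {additive V -> W}).

Definition tf_map (u : tf_quot V) : tf_quot W :=
  tf_pi (f (repr (u : Quotient.quot (@torsion V)))).

Lemma tf_map_pi x : tf_map (tf_pi x) = tf_pi (f x).
Proof.
apply/eqP; rewrite -[_ == _]Quotient.idealrBE -raddfB.
set y := _ - _; have /asboolP [n n0 yn] : y \in @torsion V.
  by rewrite Quotient.idealrBE reprK.
by apply/asboolP; exists n => //; rewrite -raddfMn yn raddf0.
Qed.

End TorsionFreeQuotientMap.

(* Tensor product over Z: free abelian group on V * W modulo bilinearity. *)

Section Tensor.
Variables V W : zmodType.

Local Notation F := {freeg (V * W)%type / int}.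

Definition free_pair (x : V) (y : W) : F := << (x, y) >>.

Inductive tensor_rel : F -> Prop :=
| tensor_rel0 : tensor_rel 0
| tensor_relB s t : tensor_rel s -> tensor_rel t -> tensor_rel (s - t)
| tensor_relDl x x' y :
    tensor_rel (free_pair (x + x') y - free_pair x y - free_pair x' y)
| tensor_relDr x y y' :
    tensor_rel (free_pair x (y + y') - free_pair x y - free_pair x y').

Definition tensor_relb : {pred F} := fun t => `[< tensor_rel t >].

Lemma tensor_relb_zmod_closed : zmod_closed tensor_relb.
Proof.
split=> [|s t /asboolP rs /asboolP rt]; apply/asboolP.
  exact: tensor_rel0.
exact: tensor_relB.
Qed.

HB.instance Definition _ := GRing.isZmodClosed.Build F tensor_relb
  tensor_relb_zmod_closed.

Definition tensor : zmodType := Quotient.quot tensor_relb.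

Definition tensor_pi (t : F) : tensor := \pi_(Quotient.quot tensor_relb) t.

Definition pure_tensor (x : V) (y : W) : tensor := tensor_pi (free_pair x y).

End Tensor.

Section TensorMap.
Variables (V V' W : zmodType) (f : {additive V -> V'}).

(* The map f (x) id_W, induced by (x, y) |-> (f x, y) on free groups. *)
Definition free_map :
    {freeg (V * W)%type / int} -> {freeg (V' * W)%type / int} :=
  fglift (fun p : V * W => free_pair (f p.1) p.2).

Definition tensor_map (u : tensor V W) : tensor V' W :=
  tensor_pi (free_map (repr (u : Quotient.quot (@tensor_relb V W)))).

Lemma free_map_pair x y : free_map (free_pair x y) = free_pair (f x) y.
Proof. by rewrite /free_map liftU scale1r. Qed.

Lemma free_mapB : zmod_morphism free_map.
Proof. exact: lift_is_additive. Qed.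

Lemma tensor_rel_map t : tensor_rel t -> tensor_rel (free_map t).
Proof.
elim=> {t} [|s t _ rs _ rt|x x' y|x y y'].
- by rewrite -(subrr 0) free_mapB subrr; apply: tensor_rel0.
- by rewrite free_mapB; apply: tensor_relB.
- by rewrite !free_mapB !free_map_pair raddfD; apply: tensor_relDl.
- by rewrite !free_mapB !free_map_pair; apply: tensor_relDr.
Qed.

Lemma tensor_map_pi t : tensor_map (tensor_pi t) = tensor_pi (free_map t).
Proof.
apply/eqP; rewrite -[_ == _]Quotient.idealrBE -free_mapB.
apply/asboolP/tensor_rel_map/asboolP.
by rewrite -[X in is_true X]/(_ \in @tensor_relb V W)
  Quotient.idealrBE reprK.
Qed.

Lemma tensor_map_pure x y :
  tensor_map (pure_tensor x y) = pure_tensor (f x) y.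
Proof. by rewrite tensor_map_pi free_map_pair. Qed.

End TensorMap.

(* The torsion-free abelianization of H and the action induced on it. *)
Definition abf (H : groupType) : zmodType := tf_quot (ab H).

Definition abf_act (K H : groupType) (a : aut_action K H) (k : K) :
  abf H -> abf H := tf_map (ab_map (a k)).

(* The rational abelianization of H and the action induced on it. *)
Definition abQ (H : groupType) : zmodType := tensor (ab H) rat.

Definition abQ_act (K H : groupType) (a : aut_action K H) (k : K) :
  abQ H -> abQ H := @tensor_map _ _ rat (ab_map (a k)).

(* Main.v *)
Require Import Defs.
From mathcomp Require Import all_boot all_algebra.
From HB Require Import structures.
From mathcomp Require Import generic_quotient.
From mathcomp Require Import boolp classical_sets.
From mathcomp Require Import freeg.

Set Implicit Arguments.
Unset Strict Implicit.
Unset Printing Implicit Defensive.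

Import GRing.Theory.

Local Open Scope group_scope.
Local Open Scope classical_set_scope.
Local Open Scope quotient_scope.

(** Call a normal subgroup isolated when it is closed under taking roots, i.e.
    when the quotient is torsion-free, and let D_0 = G and D_(n+1) be the least
    isolated normal subgroup containing [D_n, G].  Each G / D_n is torsion-free
    nilpotent, and D_n dies in every torsion-free nilpotent quotient whose n-th
    lower central term is trivial ([isolated_lcs_sub]); hence G is RTFN iff the
    D_n intersect trivially ([RTFN_isolated_lcs]).  As morphisms respect these
    series, the factors H and K inherit the property from H ><| K.

    For the converse, the hypothesis says that K acts trivially on
    D_0(H) / D_1(H).  Since D_(n+1) is generated, up to roots, by commutators,
    K acts trivially on every D_n(H) / D_(n+1)(H) ([graded_action_trivial]); the
    induction uses the inclusion of [D_m, D_n] in D_(m+n+1).  An element k of K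
    has depth n if it shifts the filtration of H by n + 1 steps, i.e. maps each
    x in D_i to x modulo D_(i+n+1).  The elements of depth n form an isolated
    normal subgroup of K, and commutators with K raise the depth
    ([isolated_action_depth], [action_depth_commg]).  Consequently the pairs
    (h, k) with h in D_n(H) and k of depth n form a central series of isolated
    subgroups of H ><| K, so they contain D_n(H ><| K): in particular the latter
    meets H inside D_n(H), which separates the elements of H.  The remaining
    elements are separated by the projection to K.  Applied to H acting on
    itself by conjugation, the notion of depth also yields the inclusion of
    [D_m, D_n] in D_(m+n+1).

    The two forms of the hypothesis agree because each says that f x - x is a
    torsion element for every x in the abelianization, f being the action of an
    element of K.  For the rational form this requires that x (x) 1 = 0 only if
    x is torsion; as only finitely many bilinearity relations are involved,
    multiplying by a common denominator turns them into relations that hold in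
    the abelian group itself ([scaled_eval_rel]). *)

(** * Isolated normal subgroups and quotients *)

Record normal_subgroup (G : groupType) (F : set G) : Prop := NormalSubgroup {
  normal1 : F 1;
  normalM : forall x y, F x -> F y -> F (x * y);
  normalV : forall x, F x -> F x^-1;
  normalJ : forall x y, F x -> F (x ^ y)
}.

Definition root_closed (G : groupType) (F : set G) : Prop :=
  forall x n, (0 < n)%N -> F (x ^+ n) -> F x.

Definition isolated (G : groupType) (F : set G) : Prop :=
  normal_subgroup F /\ root_closed F.

Section Quotient.
Variables (G : groupType) (F : set G) (nF : normal_subgroup F).

Definition coset_eq (x y : G) : bool := `[< F (x * y^-1) >].

Lemma coset_eq_refl : reflexive coset_eq.
Proof. by move=> x; apply/asboolP; rewrite mulgV; apply: normal1. Qed.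

Lemma coset_eq_sym : symmetric coset_eq.
Proof.
by move=> x y; apply/asboolP/asboolP => /(normalV nF); rewrite invgM invgK.
Qed.

Lemma coset_eq_trans : transitive coset_eq.
Proof.
move=> y x z /asboolP dxy /asboolP dyz; apply/asboolP.
by rewrite -(mulgVK y x) -mulgA; apply: normalM.
Qed.

Definition coset_rel : equiv_rel G :=
  EquivRel coset_eq coset_eq_refl coset_eq_sym coset_eq_trans.

Definition coset_group : Type := {eq_quot coset_rel}.
HB.instance Definition _ : EqQuotient G coset_rel coset_group :=
  EqQuotient.on coset_group.
HB.instance Definition _ := Choice.on coset_group.

Definition coset_pi (x : G) : coset_group := \pi_coset_group x.

Lemma coset_piP (x y : G) : coset_pi x = coset_pi y <-> F (x * y^-1).
Proof.
split=> [/eqmodP/asboolP //|dxy].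
by apply/eqmodP; apply/asboolP.
Qed.

Lemma coset_piK (u : coset_group) : coset_pi (repr u) = u.
Proof. exact: reprK. Qed.

Definition coset_one : coset_group := coset_pi 1.
Definition coset_inv (u : coset_group) : coset_group := coset_pi (repr u)^-1.
Definition coset_mul (u v : coset_group) : coset_group :=
  coset_pi (repr u * repr v).

Lemma coset_piM (x y : G) :
  coset_pi (x * y) = coset_mul (coset_pi x) (coset_pi y).
Proof.
rewrite /coset_mul; apply/coset_piP; set x' := repr _; set y' := repr _.
have dx : F (x * x'^-1) by apply/coset_piP; rewrite coset_piK.
have dy : F (y * y'^-1) by apply/coset_piP; rewrite coset_piK.
suff -> : x * y * (x' * y')^-1 = (y * y'^-1) ^ x^-1 * (x * x'^-1).
  by apply: normalM => //; apply: normalJ.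
by rewrite /conjg invgK invgM !mulgA mulgVK.
Qed.

Lemma coset_piV (x : G) : coset_pi x^-1 = coset_inv (coset_pi x).
Proof.
rewrite /coset_inv; apply/coset_piP; set x' := repr _.
have /(normalJ nF x') : F (x' * x^-1) by apply/coset_piP; rewrite coset_piK.
by rewrite /conjg invgK !mulgA mulVg mul1g.
Qed.

Lemma coset_mulA : associative coset_mul.
Proof.
move=> u v w; rewrite -(coset_piK u) -(coset_piK v) -(coset_piK w).
by rewrite -!coset_piM mulgA.
Qed.

Lemma coset_mul1g : left_id coset_one coset_mul.
Proof. by move=> u; rewrite -(coset_piK u) -coset_piM mul1g. Qed.

Lemma coset_mulg1 : right_id coset_one coset_mul.
Proof. by move=> u; rewrite -(coset_piK u) -coset_piM mulg1. Qed.

Lemma coset_mulVg : left_inverse coset_one coset_inv coset_mul.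
Proof. by move=> u; rewrite -(coset_piK u) -coset_piV -coset_piM mulVg. Qed.

Lemma coset_mulgV : right_inverse coset_one coset_inv coset_mul.
Proof. by move=> u; rewrite -(coset_piK u) -coset_piV -coset_piM mulgV. Qed.

HB.instance Definition _ := isGroup.Build coset_group
  coset_mulA coset_mul1g coset_mulg1 coset_mulVg coset_mulgV.

HB.instance Definition _ :=
  isUMagmaMorphism.Build G coset_group coset_pi (erefl _, coset_piM).

(** All that is needed of G / F; computations modulo F are done through such a
    morphism f. *)
Lemma quotient_morphism :
  exists (Q : groupType) (f : UMagmaMorphism.type G Q),
    (forall x, f x = 1 <-> F x) /\ (forall u, exists x, f x = u).
Proof.
exists (coset_group : groupType), (coset_pi : UMagmaMorphism.type _ _).
split=> [x|u]; last by exists (repr u); apply: reprK.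
split=> [/coset_piP|Fx]; first by rewrite invg1 mulg1.
by apply/coset_piP; rewrite invg1 mulg1.
Qed.

End Quotient.

Lemma kernel_eqP (G Q : groupType) (F : set G) (f : UMagmaMorphism.type G Q)
    (fF : forall x, f x = 1 <-> F x) (x y : G) :
  f x = f y <-> F (x / y).
Proof.
rewrite -fF gmulfF; split=> [->|/divg1_eq //]; exact: mulgV.
Qed.

Lemma isolated_preimage (G Q : groupType) (f : UMagmaMorphism.type G Q)
    (F : set Q) :
  isolated F -> isolated [set x | F (f x)].
Proof.
move=> [[F1 FM FV FJ] Fr]; split; last first.
  by move=> x n n0 /=; rewrite gmulfXn; apply: Fr.
split=> /= [|x y Fx Fy|x Fx|x y Fx].
- by rewrite gmulf1.
- by rewrite gmulfM; apply: FM.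
- by rewrite gmulfV; apply: FV.
- by rewrite gmulfJ; apply: FJ.
Qed.

Lemma isolated1 (G : groupType) :
  torsion_free_group G -> isolated [set (1 : G)].
Proof.
move=> tfG; split; last by move=> x n; apply: tfG.
split=> //= [x y -> ->|x ->|x y ->].
- by rewrite mulg1.
- by rewrite invg1.
- by rewrite conj1g.
Qed.

(** The least isolated normal subgroup containing A, as an intersection.  Adding
    all roots of elements of a normal subgroup need not produce a subgroup, so
    no simpler description is available in general. *)
Definition isolator (G : groupType) (A : set G) : set G :=
  [set x | forall F, isolated F -> A `<=` F -> F x].

Lemma isolated_isolator (G : groupType) (A : set G) : isolated (isolator A).
Proof.
split=> [|x n n0 Ax F iF AF]; last by apply: iF.2 (n0) _; apply: Ax.
split=> [|x y Ax Ay|x Ax|x y Ax] F iF AF.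
- exact: normal1 iF.1.
- by apply: normalM; [exact: iF.1|exact: Ax|exact: Ay].
- by apply: normalV; [exact: iF.1|exact: Ax].
- by apply: normalJ; [exact: iF.1|exact: Ax].
Qed.

(** * The isolated lower central series *)

Fixpoint isolated_lcs (G : groupType) (n : nat) : set G :=
  if n is m.+1 then
    isolator [set z | exists x y : G, @isolated_lcs G m x /\ z = [~ x, y]]
  else setT.

Arguments isolated_lcs G n : clear implicits.

Section IsolatedLowerCentralSeries.
Variable G : groupType.
Local Notation D := (isolated_lcs G).

Lemma isolated_lcsP n : isolated (D n).
Proof. by case: n => [|n]; [split | apply: isolated_isolator]. Qed.

Lemma normal_lcs n : normal_subgroup (D n).
Proof. by have [] := isolated_lcsP n. Qed.

Lemma root_closed_lcs n : root_closed (D n).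
Proof. by have [] := isolated_lcsP n. Qed.

Lemma isolated_lcs_min n (F : set G) :
  isolated F -> (forall x y, D n x -> F [~ x, y]) -> D n.+1 `<=` F.
Proof.
by move=> iF DF x; apply=> // z [u [v [Du ->]]]; apply: DF.
Qed.

Lemma isolated_lcs_commg n x y : D n x -> D n.+1 [~ x, y].
Proof. by move=> Dx F _; apply; exists x, y. Qed.

Lemma isolated_lcsS n : D n.+1 `<=` D n.
Proof.
apply: isolated_lcs_min => [|x y Dx]; first exact: isolated_lcsP.
have nD := normal_lcs n.
by rewrite commgEl; apply: normalM => //; [apply: normalV|apply: normalJ].
Qed.

Lemma isolated_lcs_le m n : (m <= n)%N -> D n `<=` D m.
Proof.
move=> /subnK <-; elim: (n - m)%N => [//|k IH] x.
by rewrite addSn => /isolated_lcsS /IH.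
Qed.

Lemma lower_central_isolated n : lower_central G n `<=` D n.
Proof.
elim: n => [//|n IH] x; have nD := normal_lcs n.+1.
elim=> {x} [x [u [v [Lu _ ->]]]||x y _ Dx _ Dy|x _ Dx].
- by apply: isolated_lcs_commg; apply: IH.
- exact: (normal1 nD).
- exact: (normalM nD).
- exact: (normalV nD).
Qed.

(** The predecessor makes the statement uniform: D n.-1 is central modulo D n,
    trivially so for n = 0. *)
Lemma isolated_lcs_quotient n :
  exists (Q : groupType) (f : UMagmaMorphism.type G Q),
    [/\ forall x, f x = 1 <-> D n x, (forall u, exists x, f x = u)
      & forall x y, D n.-1 x -> commute (f x) (f y)].
Proof.
have [Q [f [fD fS]]] := quotient_morphism (normal_lcs n).
exists Q, f; split=> // x y Dx; apply/commgP/eqP; rewrite -gmulfR; apply/fD.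
by case: n Dx {fD} => [//|n]; apply: isolated_lcs_commg.
Qed.

End IsolatedLowerCentralSeries.

Lemma isolated_lcs_morph (G G' : groupType) (f : UMagmaMorphism.type G G') n x :
  isolated_lcs G n x -> isolated_lcs G' n (f x).
Proof.
elim: n x => [//|n IH].
apply: isolated_lcs_min => [|x y Dx].
  exact/(isolated_preimage f)/isolated_lcsP.
by rewrite /= gmulfR; apply: isolated_lcs_commg; apply: IH.
Qed.

(** * Comparison with torsion-free nilpotent quotients *)

Section RelativeUpperCentralSeries.
Variables (G : groupType) (F : set G).

(** The preimage of the upper central series of G / F. *)
Fixpoint upper_central (n : nat) : set G :=
  if n is m.+1 then [set x | forall y, upper_central m [~ x, y]] else F.

Hypothesis iF : isolated F.

Lemma normal_upper_central n : normal_subgroup (upper_central n).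
Proof.
elim: n => [|n nZ]; first exact: iF.1.
have [Q [f [fZ _]]] := quotient_morphism nZ.
have ZP x : upper_central n.+1 x <-> forall y, commute (f y) (f x).
  split=> Zx y; first by apply: commute_sym; apply/commgP/eqP; rewrite -gmulfR; apply/fZ.
  by apply/fZ; rewrite gmulfR; apply/eqP/commgP; apply: commute_sym; apply: Zx.
split=> [|x y /ZP Zx /ZP Zy|x /ZP Zx|x y Zx].
- by apply/ZP => y; rewrite gmulf1; apply: commute1.
- by apply/ZP => z; rewrite gmulfM; apply: commuteM.
- by apply/ZP => z; rewrite gmulfV; apply: commuteV.
- move=> z; have -> : [~ x ^ y, z] = [~ x, z ^ y^-1] ^ y.
    by rewrite conjRg conjgKV.
  by apply: normalJ => //; apply: Zx.
Qed.

Lemma upper_central_le m n : (m <= n)%N -> upper_central m `<=` upper_central n.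
Proof.
move=> /subnK <-; elim: (n - m)%N => [//|k IH] x /IH Zx y.
have nZ := normal_upper_central (k + m).
rewrite commgEl; apply: (normalM nZ); first exact: (normalV nZ).
exact: (normalJ nZ).
Qed.

(** The factors of the upper central series of the torsion-free group G / F are
    torsion-free.  If x lies in the (n+2)-nd term and x^p in the (n+1)-st, then
    modulo the n-th term [x, y] is central and [x, y]^p = [x^p, y] = 1; so
    [x, y] lies in the n-th term by induction, for every y. *)
Lemma upper_central_root n x p : (0 < p)%N ->
  upper_central n.+1 x -> upper_central n (x ^+ p) -> upper_central n x.
Proof.
move=> p0; elim: n x => [|n IH] x Zx Zxp.
  exact: iF.2 Zxp.
move=> y; apply: IH; first exact: Zx.
have [Q [f [fZ _]]] := quotient_morphism (normal_upper_central n).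
apply/fZ; rewrite gmulfXn.
have xpy : commute (f x ^+ p) (f y).
  by apply/commgP/eqP; rewrite -gmulfXn -gmulfR; apply/fZ/Zxp.
have cx : commute (f x) (f [~ x, y]).
  apply: commute_sym; apply/commgP/eqP; rewrite -gmulfR; apply/fZ; exact: Zx.
(* Conjugating x^p by y gives both x^p and (x [x, y])^p. *)
apply: (mulgI (f x ^+ p)); rewrite -expgMn // mulg1.
have -> : f x * f [~ x, y] = f x ^ f y by rewrite -gmulfM -gmulfJ commgEl mulVKg.
by rewrite -conjXg; apply/conjg_fixP/commgP.
Qed.

Lemma upper_central_isolated N n : upper_central N = setT ->
  (n <= N)%N -> isolated (upper_central n).
Proof.
move=> ZN nN; split=> [|x p p0 Zxp]; first exact: normal_upper_central.
(* As the top term is everything, x can be brought down one factor at a time. *)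
suff : forall k, (k <= N - n)%N -> upper_central (N - k) x.
  by move=> /(_ _ (leqnn _)); rewrite subKn.
elim=> [|k IH] kN; first by rewrite subn0 ZN.
apply: (upper_central_root p0).
  rewrite -subSn ?subSS; first by apply: IH; apply: ltnW.
  exact: leq_trans kN (leq_subr _ _).
apply: (upper_central_le _ Zxp).
have kN' := leq_trans kN (leq_subr _ _).
by rewrite leq_subRL // addnC -leq_subRL.
Qed.

(** As for the ordinary series, D_k lies in the (n-k)-th upper central term
    relative to F; isolation of that term is what allows the roots in D_k. *)
Lemma isolated_lcs_sub n :
  lower_central G n `<=` F -> isolated_lcs G n `<=` F.
Proof.
move=> GF.
have LZ k : (k <= n)%N -> lower_central G (n - k) `<=` upper_central k.
  elim: k => [|k IH] kn; first by rewrite subn0.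
  move=> x Lx y; apply: IH; first exact: ltnW.
  by rewrite -(subnSK kn); apply: generated_in; exists x, y.
have ZT : upper_central n = setT.
  by apply/seteqP; split=> // x _; apply: LZ; rewrite // subnn.
suff DZ k : (k <= n)%N -> isolated_lcs G k `<=` upper_central (n - k).
  by have := DZ n (leqnn _); rewrite subnn.
elim: k => [|k IH] kn; first by rewrite subn0 ZT.
apply: isolated_lcs_min => [|x y Dx].
  by apply: upper_central_isolated ZT _; apply: leq_subr.
by have := IH (ltnW kn) x Dx; rewrite -(subnSK kn); apply.
Qed.

End RelativeUpperCentralSeries.

Lemma lower_central_morph (G G' : groupType) (f : UMagmaMorphism.type G G')
    n x :
  lower_central G n x -> lower_central G' n (f x).
Proof.
elim: n x => [//|n IH] x.
elim=> {x} [x [u [v [Lu _ ->]]]||x y _ Lx _ Ly|x _ Lx].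
- by rewrite gmulfR; apply: generated_in; exists (f u), (f v); split=> //; apply: IH.
- by rewrite gmulf1; apply: generated1.
- by rewrite gmulfM; apply: generatedM.
- by rewrite gmulfV; apply: generatedV.
Qed.

Lemma lower_central_lift (G G' : groupType) (f : UMagmaMorphism.type G G') n u :
  (forall v, exists x, f x = v) ->
  lower_central G' n u -> exists2 x, lower_central G n x & f x = u.
Proof.
move=> fS; elim: n u => [|n IH] u; first by have [x <-] := fS u; exists x.
elim=> {u} [z [u [v [/IH[x Lx <-] _ ->]]]||u v _ [x Lx <-] _ [y Ly <-]|u _ [x Lx <-]].
- have [y <-] := fS v; exists [~ x, y]; last exact: gmulfR.
  by apply: generated_in; exists x, y.
- by exists 1; [apply: generated1 | apply: gmulf1].
- by exists (x * y); [apply: generatedM | apply: gmulfM].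
- by exists x^-1; [apply: generatedV | apply: gmulfV].
Qed.

(** Residual torsion-free nilpotence only has to be tested on the canonical
    quotients by the terms of the isolated lower central series. *)
Lemma RTFN_isolated_lcs (G : groupType) :
  RTFN G <-> forall g : G, g <> 1 -> exists n, ~ isolated_lcs G n g.
Proof.
split=> RG g g1; have {RG} := RG g g1; last first.
  move=> [n Dg]; have [Q [f [fD fS _]]] := isolated_lcs_quotient G n.
  exists Q, f; split=> //.
  - move=> u p p0; have [x <-] := fS u; rewrite -gmulfXn => /fD Dxp.
    by apply/fD; apply: root_closed_lcs Dxp.
  - exists n => u /(lower_central_lift fS)[x Lx <-].
    exact/fD/lower_central_isolated.
  - by move/fD.
move=> [N [f [tfN [n nN] _ fg]]]; exists n => Dg; apply: fg.
have iK := isolated_preimage f (isolated1 tfN).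
apply: (isolated_lcs_sub iK _ Dg) => x Lx; apply: nN.
exact: lower_central_morph.
Qed.

(** * Depth of an action on the isolated lower central series *)

Section Depth.
Variables (K H : groupType) (a : aut_action K H).
Local Notation D := (isolated_lcs H).

(** The shift by one makes depth 0 mean triviality on the successive quotients,
    and matches the indexing in which D_0 is the whole group. *)
Definition action_depth (n : nat) : set K :=
  [set k | forall i x, D i x -> D (i + n).+1 (a k x / x)].

Hypothesis depth0 : forall k, action_depth 0 k.

Let actV k x : a k^-1 (a k x) = x.
Proof. by rewrite -aut_actM mulVg aut_act1. Qed.

(** Write k x = c x and l x = d x.  Modulo D_(i+n+2), k fixes d and l fixes c, so
    k (l x) = d c x and l (k x) = c d x, and c is central there. *)
Lemma action_depth_commg n k l :
  action_depth n k -> action_depth n.+1 [~ k, l].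
Proof.
move=> dk i x Dx; have [Q [f [fD _ fC]]] := isolated_lcs_quotient H (i + n.+1).+1.
have -> : [~ k, l] = (l * k)^-1 * (k * l) by rewrite invgM -!mulgA.
rewrite aut_actM -[x in _ / x](actV (l * k)) -gmulfF.
apply: isolated_lcs_morph; apply/(kernel_eqP fD); rewrite !aut_actM.
have [c ck Dc] : exists2 c, a k x = c * x & D (i + n.+1) c.
  by exists (a k x / x); rewrite ?mulgVK // addnS; apply: dk.
have [d dl Dd] : exists2 d, a l x = d * x & D i.+1 d.
  exists (a l x / x); rewrite ?mulgVK //.
  by have := depth0 l Dx; rewrite addn0.
rewrite dl ck !gmulfM dl ck !gmulfM.
have -> : f (a k d) = f d.
  by apply/(kernel_eqP fD); have := dk _ _ Dd; rewrite addSnnS.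
have -> : f (a l c) = f c.
  by apply/(kernel_eqP fD); have := depth0 l Dc; rewrite addn0.
by rewrite !mulgA (fC c d).
Qed.

(** Closure under roots is a unipotence argument: if k has depth j and k x = c x,
    then modulo the next term k fixes c, so k^p x = c^p x.  If k^p has larger
    depth then c^p, hence c, lies in that next term. *)
Lemma isolated_action_depth n : isolated (action_depth n).
Proof.
split; last first.
  move=> k p p0 dkp.
  suff : forall j, (j <= n)%N -> action_depth j k by exact.
  elim=> [//|j IH] jn i x Dx.
  have {}IH := IH (ltnW jn).
  have [Q [f [fD _ _]]] := isolated_lcs_quotient H (i + j.+1).+1.
  have Dc : D (i + j).+1 (a k x / x) by apply: IH.
  apply: (root_closed_lcs p0); apply/fD; rewrite gmulfXn.
  have fkq q : f (a (k ^+ q) x) = f (a k x / x) ^+ q * f x.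
    elim: q => [|q IHq]; first by rewrite aut_act1 mul1g.
    rewrite expgSr aut_actM -[a k x](mulgVK x) 2!gmulfM IHq mulgK.
    have -> : f (a (k ^+ q) (a k x / x)) = f (a k x / x).
      by apply/(kernel_eqP fD); have := depth0 (k ^+ q) Dc; rewrite addn0 addnS.
    by rewrite expgS mulgA.
  apply: (mulIg (f x)); rewrite -fkq mul1g; apply/(kernel_eqP fD).
  apply: isolated_lcs_le (dkp i x Dx).
  by rewrite ltnS leq_add2l.
split=> [i x Dx|k l dk dl i x Dx|k dk i x Dx|k l dk i x Dx].
- by rewrite aut_act1 mulgV; apply: (normal1 (normal_lcs H _)).
- have -> : a (k * l) x / x = (a k (a l x) / a l x) * (a l x / x).
    by rewrite aut_actM mulgA mulgVK.
  apply: (normalM (normal_lcs H _)); last exact: dl.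
  by apply: dk; apply: isolated_lcs_morph.
- have kx : a k (a k^-1 x) = x by rewrite -aut_actM mulgV aut_act1.
  rewrite -{2}kx -invgF; apply: (normalV (normal_lcs H _)).
  by apply: dk; apply: isolated_lcs_morph.
- rewrite conjgE !aut_actM -[x in _ / x](actV l) -gmulfF.
  by apply: isolated_lcs_morph; apply: dk; apply: isolated_lcs_morph.
Qed.

Lemma isolated_lcs_depth n : isolated_lcs K n `<=` action_depth n.
Proof.
elim: n => [k _ //|n IH].
apply: isolated_lcs_min => [|k l Dk]; first exact: isolated_action_depth.
by apply: action_depth_commg; apply: IH.
Qed.

End Depth.

(** * Propagation of triviality from the abelianization *)

Section InnerAction.
Variable G : groupType.
Local Notation D := (isolated_lcs G).

Definition inner (g x : G) : G := x ^ g^-1.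

HB.instance Definition _ g :=
  isUMagmaMorphism.Build G G (inner g)
    (conj1g g^-1, fun x y => conjMg x y g^-1).

Lemma inner1 x : inner 1 x = x.
Proof. by rewrite /inner invg1 conjg1. Qed.

Lemma innerM g h x : inner (g * h) x = inner g (inner h x).
Proof. by rewrite /inner invgM conjgM. Qed.

Definition inner_action : aut_action G G :=
  @AutAction G G (fun g => inner g : UMagmaMorphism.type G G) inner1 innerM.

(** The isolated series is strongly central: under conjugation the n-th term acts
    with depth n, by [isolated_lcs_depth]. *)
Lemma isolated_lcs_commg_add m n x y :
  D m x -> D n y -> D (m + n).+1 [~ x, y].
Proof.
have E g z : inner_action g z / z = [~ g^-1, z^-1].
  by rewrite /= /inner commgEr invgK.
move=> Dx Dy; rewrite -[x]invgK -[y]invgK -E addnC.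
have [_ _ VD _] := normal_lcs G m; have [_ _ VD' _] := normal_lcs G n.
apply: (@isolated_lcs_depth _ _ inner_action) (VD _ Dx) _ _ (VD' _ Dy).
move=> k i z Dz; rewrite E -invgR addn0.
apply: (normalV (normal_lcs G _)); apply: isolated_lcs_commg.
exact: (normalV (normal_lcs G _)).
Qed.

End InnerAction.

Lemma commg_congr (G : groupType) (c d x y : G) :
  (forall z, commute c z) -> commute x d -> [~ c * x, d * y] = [~ x, y].
Proof.
move=> cC dx; have cz z : c ^ z = c by apply/conjg_fixP/commgP.
have xd : x ^ d = x by apply/conjg_fixP/commgP.
by rewrite !commgEl conjMg cz invgM -mulgA mulKg conjgM xd.
Qed.

Section GradedTrivial.
Variables (K H : groupType) (a : aut_action K H).
Local Notation D := (isolated_lcs H).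
Hypothesis a_triv : forall k x, D 1 (a k x / x).

(** By induction on i, a k [x, y] = [c x, d y] with c in D_(i+1) and d in D_1.
    Modulo D_(i+2), c is central, and d commutes with x by strong centrality;
    so a k fixes [x, y].  The elements of D_(i+1) fixed modulo D_(i+2) form an
    isolated subgroup, because D_(i+1) is central there. *)
Lemma graded_action_trivial k : action_depth a 0 k.
Proof.
move=> i x; rewrite addn0.
elim: i x k => [|i IH] x k Dx; first exact: a_triv.
have [Q [f [fD fS fC]]] := isolated_lcs_quotient H i.+2.
pose F := [set z | D i.+1 z /\ forall k, f (a k z) = f z].
suff : F x by case=> _ /(_ k) /(kernel_eqP fD).
have DJ := isolated_lcs_morph.
have nD := normal_lcs H i.+1.
apply: isolated_lcs_min Dx; last first.
  move=> {x k} x y Dx; split=> [|k]; first exact: isolated_lcs_commg.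
  rewrite !gmulfR; have [c -> Dc] : exists2 c, a k x = c * x & D i.+1 c.
    by exists (a k x / x); [rewrite mulgVK | apply: IH].
  have [d -> Dd] : exists2 d, a k y = d * y & D 1 d.
    by exists (a k y / y); rewrite ?mulgVK.
  rewrite !gmulfM; apply: commg_congr => [z|].
    by have [y' <-] := fS z; apply: fC.
  apply/commgP/eqP; rewrite -gmulfR; apply/fD.
  by rewrite -[i.+1]addn1; apply: isolated_lcs_commg_add.
split=> [|{x k} x p p0 [Dxp fxp]]; last first.
  have Dx : D i.+1 x by apply: root_closed_lcs Dxp.
  split=> // k; apply/(kernel_eqP fD); apply: (root_closed_lcs p0).
  apply/fD; rewrite gmulfXn gmulfF expgnFl; last exact/fC/DJ.
  by rewrite -!gmulfXn fxp mulgV.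
split=> [|{x k} x y [Dx fx] [Dy fy]|{x k} x [Dx fx]|{x k} x y [Dx fx]].
- by split=> [|l]; [apply: (normal1 nD) | rewrite !gmulf1].
- by split=> [|k]; [apply: (normalM nD) | rewrite !gmulfM fx fy].
- by split=> [|k]; [apply: (normalV nD) | rewrite !gmulfV fx].
- split=> [|k]; first exact: (normalJ nD).
  have fxJ z : f x ^ f z = f x by apply/conjg_fixP/commgP/fC.
  by rewrite !gmulfJ fx !fxJ.
Qed.

End GradedTrivial.

(** * The semidirect product *)

Section SemidirectFiltration.
Variables (K H : groupType) (a : aut_action K H).
Hypothesis a_triv : forall k x, isolated_lcs H 1 (a k x / x).
Local Notation S := (semidirect a).
Local Notation D := (isolated_lcs H).

Definition sd_filtration (n : nat) : set S :=
  [set s | D n s.1 /\ action_depth a n s.2].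

Let a0 := graded_action_trivial a_triv.
Let nD n : normal_subgroup (D n) := normal_lcs H n.
Let nK n : normal_subgroup (action_depth a n) := (isolated_action_depth a0 n).1.
Let DJ k n x : D n x -> D n (a k x) := @isolated_lcs_morph H H (a k) n x.

Lemma action_depth_le m n : (m <= n)%N -> action_depth a n `<=` action_depth a m.
Proof.
move=> mn k dk i x Dx; apply: isolated_lcs_le (dk i x Dx).
by rewrite ltnS leq_add2l.
Qed.

Lemma sd_filtrationS n : sd_filtration n.+1 `<=` sd_filtration n.
Proof.
by move=> s [Dh dk]; split; [apply: isolated_lcsS | apply: action_depth_le dk].
Qed.

(** Modulo D_(n+1), l fixes h, k fixes g, and h is central, so the first
    components h (k g) of s t and g (l h) of t s agree. *)
Lemma sd_filtration_commg n (s t : S) :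
  sd_filtration n s -> sd_filtration n.+1 [~ s, t].
Proof.
case: s t => h k [g l] [/= Dh dk].
have -> : [~ (h, k) : S, (g, l) : S] =
    (a (l * k)^-1 ((g * a l h)^-1 * (h * a k g)), [~ k, l]) :> S.
  have E (G : groupType) (x y : G) : [~ x, y] = (y * x)^-1 * (x * y).
    by rewrite invgM -!mulgA.
  by rewrite !E gmulfM.
split; last exact: action_depth_commg.
apply: DJ; have [Q [f [fD _ fC]]] := isolated_lcs_quotient H n.+1.
apply/fD; rewrite gmulfM gmulfV.
suff -> : f (g * a l h) = f (h * a k g) by rewrite mulVg.
rewrite !gmulfM.
have -> : f (a l h) = f h.
  by apply/(kernel_eqP fD); have := a0 l Dh; rewrite addn0.
have -> : f (a k g) = f g by apply/(kernel_eqP fD); apply: (dk 0).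
by rewrite (fC h g).
Qed.

(** For roots: once k has depth n, it acts trivially on H modulo D_n, so that the
    first component of (h, k)^p is h^p modulo D_n. *)
Lemma isolated_sd_filtration n : isolated (sd_filtration n).
Proof.
have FM (s t : S) : sd_filtration n s -> sd_filtration n t -> sd_filtration n (s * t).
  move=> [Ds ds] [Dt dt]; split; last exact: (normalM (nK n)).
  by apply: (normalM (nD n)) => //; apply: DJ.
split; last first.
  move=> [h k] p p0 [/= Dhp dkp].
  have [Q [f [fD _ _]]] := isolated_lcs_quotient H n.
  have skp q : ((h, k) : S) ^+ q = ((((h, k) : S) ^+ q).1, k ^+ q).
    by elim: q => [//|q IH]; rewrite !expgS {1}IH.
  have dk : action_depth a n k.
    apply: ((isolated_action_depth a0 n).2 _ _ p0).
    by rewrite skp in dkp.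
  split=> //=; apply: (root_closed_lcs p0); apply/fD; rewrite gmulfXn.
  move/fD: Dhp <-; elim: {p0 dkp} p => [|p IH]; first by rewrite gmulf1.
  rewrite !expgS /= gmulfM IH; congr (_ * _).
  apply/esym/(kernel_eqP fD)/isolated_lcsS.
  exact: isolated_lcs_le (dk 0 _ I).
split=> [|s t Fs Ft|s [Ds ds]|s t Fs].
- by split; [apply: (normal1 (nD n)) | apply: (normal1 (nK n))].
- exact: FM.
- by split; [apply/DJ/(normalV (nD n)) | apply: (normalV (nK n))].
- have -> : s ^ t = s * [~ s, t] by rewrite commgEl mulVKg.
  by apply: FM => //; apply/sd_filtrationS/sd_filtration_commg.
Qed.

Lemma isolated_lcs_semidirect n : isolated_lcs S n `<=` sd_filtration n.
Proof.
elim: n => [s _|n IH]; first by split=> //; apply: a0.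
apply: isolated_lcs_min => [|s t Ds]; first exact: isolated_sd_filtration.
by apply: sd_filtration_commg; apply: IH.
Qed.

End SemidirectFiltration.

Section RTFNSemidirect.
Variables (K H : groupType) (a : aut_action K H).
Local Notation S := (semidirect a).

Definition sd_inl (h : H) : S := (h, 1).
Definition sd_inr (k : K) : S := (1, k).
Definition sd_snd (s : S) : K := s.2.

Lemma sd_inlM : {morph sd_inl : x y / x * y}.
Proof. by move=> x y; congr (_, _); rewrite /= ?aut_act1 ?mulg1. Qed.

Lemma sd_inrM : {morph sd_inr : x y / x * y}.
Proof. by move=> x y; congr (_, _); rewrite /= gmulf1 mulg1. Qed.

HB.instance Definition _ := isUMagmaMorphism.Build H S sd_inl (erefl _, sd_inlM).
HB.instance Definition _ := isUMagmaMorphism.Build K S sd_inr (erefl _, sd_inrM).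
HB.instance Definition _ := isUMagmaMorphism.Build S K sd_snd
  (erefl _, fun _ _ => erefl _).

Lemma RTFN_semidirect :
  (forall k x, isolated_lcs H 1 (a k x / x)) ->
  RTFN S <-> RTFN H /\ RTFN K.
Proof.
move=> a_triv; rewrite !RTFN_isolated_lcs; split=> [RS|[RH RK] [h k] hk1].
  split=> g g1.
    have [|n nD] := RS (sd_inl g); first by case.
    by exists n => /(isolated_lcs_morph sd_inl).
  have [|n nD] := RS (sd_inr g); first by case.
  by exists n => /(isolated_lcs_morph sd_inr).
have [k1|/eqP/RK[n nD]] := eqVneq k 1; last first.
  by exists n => /(isolated_lcs_morph sd_snd).
have [|n nD] := RH h; first by move=> h1; apply: hk1; rewrite h1 k1.
by exists n => /(isolated_lcs_semidirect a_triv)[].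
Qed.

End RTFNSemidirect.

(** * The two forms of the hypothesis *)

Section RationalTensor.
Local Open Scope ring_scope.
Variable V : zmodType.
Local Notation F := {freeg (V * rat)%type / int}.

Definition is_torsion (x : V) : Prop := exists2 n : nat, (0 < n)%N & x *+ n = 0.

Lemma tf_pi_eqP (x y : V) : tf_pi x = tf_pi y <-> is_torsion (x - y).
Proof.
split=> [/eqP|tor]; last apply/eqP; rewrite -[_ == _]Quotient.idealrBE.
  by move/asboolP.
exact/asboolP.
Qed.

Lemma tensor_pi_eqP (s t : F) : tensor_pi s = tensor_pi t <-> tensor_rel (s - t).
Proof.
split=> [/eqP|tor]; last apply/eqP; rewrite -[_ == _]Quotient.idealrBE.
  by move/asboolP.
exact/asboolP.
Qed.

Lemma tensor_pi_is_additive : zmod_morphism (@tensor_pi V rat).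
Proof. exact: raddfB. Qed.

HB.instance Definition _ :=
  GRing.isZmodMorphism.Build F (tensor V rat) (@tensor_pi V rat)
    tensor_pi_is_additive.

(** The evaluation x (x) q |-> (q N) x.  It is meaningful only when q N is an
    integer; for other q the value is irrelevant junk, which is why additivity
    in q only holds for N divisible by the denominators involved. *)
Definition scaled_eval (N : nat) : F -> V :=
  fglift ((fun p => p.1 *~ numq (p.2 *+ N)) : V * rat -> zmodule V).

Lemma scaled_eval_is_additive N : zmod_morphism (scaled_eval N).
Proof. exact: (@lift_is_additive _ _ (zmodule V)). Qed.

HB.instance Definition _ N :=
  GRing.isZmodMorphism.Build F V (scaled_eval N) (scaled_eval_is_additive N).

Lemma scaled_eval_pair N x q :
  scaled_eval N (free_pair x q) = x *~ numq (q *+ N).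
Proof. by rewrite /scaled_eval liftU scale1r. Qed.

Lemma mulrn_denq (q : rat) m : exists z : int, q *+ (`|denq q| * m) = z%:~R.
Proof.
exists (numq q *+ m); rewrite mulrnA rmorphMn /= numqE; congr (_ *+ m).
by rewrite -absz_denq -mulr_natr.
Qed.

(** A derivation of [tensor_rel t] involves finitely many rationals, and N is a
    common multiple of their denominators.  All multiples of N are allowed so
    that the values of N for two relations can be combined. *)
Lemma scaled_eval_rel (t : F) : tensor_rel t ->
  exists2 N : nat, (0 < N)%N & forall m, scaled_eval (N * m) t = 0.
Proof.
elim=> {t} [|s t _ [M M0 sM] _ [N N0 tN]|x x' y|x y y'].
- by exists 1%N => // m; rewrite raddf0.
- exists (M * N)%N => [|m]; first by rewrite muln_gt0 M0.
  rewrite raddfB /= -[X in scaled_eval X t]mulnA mulnCA tN.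
  by rewrite -mulnA sM subrr.
- exists 1%N => // m; rewrite !raddfB /= !scaled_eval_pair mulrzDl.
  by rewrite addrAC addrK subrr.
- exists (`|denq y| * `|denq y'|)%N => [|m].
    by rewrite muln_gt0 !absz_gt0 !denq_eq0.
  have [z yz] := mulrn_denq y (`|denq y'| * m).
  have [z' yz'] := mulrn_denq y' (`|denq y| * m).
  rewrite !raddfB /= !scaled_eval_pair mulrnDl.
  rewrite -[X in y *+ X]mulnA yz.
  rewrite [X in y' *+ (X * m)]mulnC -[X in y' *+ X]mulnA yz' -intrD !numq_int.
  by rewrite mulrzDr addrAC addrK subrr.
Qed.

(** The map V -> V (x) Q has torsion kernel: evaluating a vanishing x (x) 1 at a
    suitable N gives N x = 0. *)
Lemma torsion_pure_tensor1 (x : V) :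
  pure_tensor x (1 : rat) = 0 -> is_torsion x.
Proof.
rewrite -(raddf0 (@tensor_pi V rat)).
move/tensor_pi_eqP; rewrite subr0 => /scaled_eval_rel[N N0 /(_ 1%N)].
rewrite scaled_eval_pair muln1 (_ : 1 *+ N = N%:~R) // numq_int => xN.
by exists N.
Qed.


Lemma pure_tensorDl (x y : V) (q : rat) :
  pure_tensor (x + y) q = pure_tensor x q + pure_tensor y q.
Proof.
rewrite /pure_tensor -raddfD; apply/tensor_pi_eqP; rewrite opprD addrA.
exact: tensor_relDl.
Qed.

Lemma pure_tensorDr (x : V) (p q : rat) :
  pure_tensor x (p + q) = pure_tensor x p + pure_tensor x q.
Proof.
rewrite /pure_tensor -raddfD; apply/tensor_pi_eqP; rewrite opprD addrA.
exact: tensor_relDr.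
Qed.

Lemma pure_tensorB (x y : V) (q : rat) :
  pure_tensor (x - y) q = pure_tensor x q - pure_tensor y q.
Proof. by have := pure_tensorDl (x - y) y q; rewrite subrK => ->; rewrite addrK. Qed.

Lemma pure_tensor0 (q : rat) : pure_tensor (0 : V) q = 0.
Proof. by rewrite -(subrr (0 : V)) pure_tensorB subrr. Qed.

Lemma pure_tensorMn (x : V) (q : rat) n :
  pure_tensor (x *+ n) q = pure_tensor x (q *+ n).
Proof.
have x0 : pure_tensor x (0 : rat) = 0.
  by apply: (addrI (pure_tensor x 0)); rewrite -pure_tensorDr !addr0.
elim: n => [|n IH]; first by rewrite pure_tensor0 x0.
by rewrite !mulrS pure_tensorDl pure_tensorDr IH.
Qed.

Lemma torsion_pure_tensor (x : V) (q : rat) :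
  is_torsion x -> pure_tensor x q = 0.
Proof.
move=> [n n0 xn]; have -> : q = q / n%:R *+ n.
  by rewrite -mulr_natr mulfVK // Num.Theory.pnatr_eq0 -lt0n.
by rewrite -pure_tensorMn xn pure_tensor0.
Qed.

Variable f : {additive V -> V}.

Lemma tf_map_id : (forall u, tf_map f u = u) <-> forall x, is_torsion (f x - x).
Proof.
split=> [fu x|tor u]; first by apply/tf_pi_eqP; rewrite -tf_map_pi fu.
have <- : tf_pi (repr (u : Quotient.quot (@torsion V))) = u by exact: reprK.
by rewrite tf_map_pi; apply/tf_pi_eqP.
Qed.

HB.instance Definition _ :=
  GRing.isZmodMorphism.Build F F (@free_map V V rat f) (free_mapB f).

Lemma tensor_map_id : (forall u, @tensor_map V V rat f u = u) <->
  forall x, is_torsion (f x - x).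
Proof.
split=> [fu x|tor u].
  by apply: torsion_pure_tensor1; rewrite pure_tensorB -tensor_map_pure fu subrr.
have <- : tensor_pi (repr (u : Quotient.quot (@tensor_relb V rat))) = u.
  exact: reprK.
rewrite tensor_map_pi; set t := repr _.
rewrite -(freeg_sumE t) !raddf_sum; apply: eq_bigr => -[x q] _ /=.
rewrite -[coeff _ _]intz -freegU_mulz !raddfMz; congr (_ *~ _).
apply/eqP; rewrite -subr_eq0; apply/eqP.
have := torsion_pure_tensor q (tor x).
by rewrite pure_tensorB -tensor_map_pure tensor_map_pi.
Qed.

End RationalTensor.

Section Abelianized.
Local Open Scope ring_scope.
Variable H : groupType.

Lemma ab_piX (x : H) n : ab_pi (x ^+ n)%g = ab_pi x *+ n.
Proof.
elim: n => [|n IH]; first by [].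
by rewrite expgS mulrS ab_piD IH.
Qed.

(** A multiple of a class vanishes in the abelianization when a power of the
    element lies in the derived subgroup, the lower central term of index 1. *)
Lemma ab_torsion_isolated_lcs (x y : H) :
  is_torsion (ab_pi x - ab_pi y) -> isolated_lcs H 1 (x / y)%g.
Proof.
move=> [n n0]; rewrite -ab_piB -ab_piX => /ab_piP.
rewrite invg1 mulg1 => dxy; apply: (root_closed_lcs n0).
exact: (@lower_central_isolated H 1).
Qed.

End Abelianized.

Theorem corollary7p17 (K H : groupType) (a : aut_action K H) :
  ((forall (k : K) (u : abQ H), abQ_act a k u = u) <->
   (forall (k : K) (u : abf H), abf_act a k u = u)) /\
  ((forall (k : K) (u : abQ H), abQ_act a k u = u) ->
   (RTFN (semidirect a) <-> RTFN H /\ RTFN K)).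
Proof.
have QE k := tensor_map_id (ab_map (a k)).
have fE k := tf_map_id (ab_map (a k)).
split; first by split=> aid k; [apply/fE/QE | apply/QE/fE]; apply: aid.
move=> aid; apply: RTFN_semidirect => k x; apply: ab_torsion_isolated_lcs.
by rewrite -ab_map_pi; move: (ab_pi x); apply/QE/aid.
Qed.
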